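(* Let $\mu$ be real with $0.7496\le2\mu<1$. Then there exist $c>0$ and $M$ such that for all integers $m\ge M$ for which $n=2\mu m$ is an integer, all primes $p$, all MDS codes $C\subseteq\mathbb{F}_p^{m+1}$ of dimension $n$ (coordinates indexed by $0,1,\dots,m$), all leakage functions $h_1,\dots,h_m:\mathbb{F}_p\to\{-1,1\}$, and all secrets $s,s'\in\mathbb{F}_p$, $$d_{\mathrm{TV}}\bigl(L(s),L(s')\bigr)\le 2^{-cm}.$$ That is, the Massey secret sharing scheme on an MDS code over a prime field is one-bit local leakage resilient for rate at least $0.7496$.
   Context: A linear code $C\subseteq\mathbb{F}_p^{N}$ of dimension $n$ is MDS if any $n$ coordinates of a codeword determine the codeword. In Massey's secret sharing scheme with $m$ parties based on $C\subseteq\mathbb{F}_p^{m+1}$, a secret $s\in\mathbb{F}_p$ is shared by choosing a uniformly random codeword $c\in C$ subject to $c_0=s$ and giving $c_i$ to party $i$, for $i=1,\dots,m$. Each party $i$ leaks the single bit $h_i(c_i)\in\{-1,1\}$, and $L(s)=(h_1(c_1),\dots,h_m(c_m))\in\{-1,1\}^m$ is the (random) leakage transcript. The scheme is one-bit local leakage resilient if, for all choices of leakage functions and any two secrets $s,s'$, the total variation distance $d_{\mathrm{TV}}(L(s),L(s'))$ is at most $2^{-\Omega(m)}$. *)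

(* Defs.v *)
From HB Require Import structures.
From mathcomp Require Import all_boot all_order all_algebra.
From mathcomp Require Import all_classical all_reals all_analysis.
Set Implicit Arguments.
Unset Strict Implicit.
Unset Printing Implicit Defensive.
Import Order.TTheory GRing.Theory Num.Theory.
Local Open Scope ring_scope.

(* The two-element set {-1, 1} of integers, as a finite type. *)
Definition sign : finType := seq_sub [:: -1; 1 : int].

(* For a linear code, with n = \dim C: any n coordinates of a codeword
   determine it. *)
Definition MDS (F : fieldType) (N : nat) (C : {vspace 'rV[F]_N}) : Prop :=
  forall I : {set 'I_N}, #|I| = \dim C ->
  forall c c' : 'rV[F]_N, c \in C -> c' \in C ->
    (forall i, i \in I -> c 0 i = c' 0 i) -> c = c'.

(* Probability mass function of X under the uniform distribution on A;
   identically 0 when A is empty. *)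
Definition uniform_pmf (R : realType) (W T : finType) (A : {set W}) (X : W -> T)
    (t : T) : R :=
  #|[set w in A | X w == t]|%:R / #|A|%:R.

Definition dTV (R : realType) (T : finType) (P Q : T -> R) : R :=
  2^-1 * \sum_(t : T) `|P t - Q t|.

Section Massey.
Variables (F : finFieldType) (m : nat).

(* Coordinate 0 of a codeword carries the secret; party i : 'I_m, counted from
   0, receives coordinate lift ord0 i = i + 1. *)
Definition sharings (C : {vspace 'rV[F]_m.+1}) (s : F) : {set 'rV[F]_m.+1} :=
  [set c : 'rV[F]_m.+1 | (c \in C) && (c 0 ord0 == s)].

Definition transcript (h : 'I_m -> F -> sign) (c : 'rV[F]_m.+1) :
    {ffun 'I_m -> sign} :=
  [ffun i => h i (c 0 (lift ord0 i))].

(* Distribution of the leakage transcript L(s). *)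
Definition leakage (R : realType) (C : {vspace 'rV[F]_m.+1})
    (h : 'I_m -> F -> sign) (s : F) : {ffun 'I_m -> sign} -> R :=
  uniform_pmf R (sharings C s) (transcript h).

End Massey.

(* Main.v *)
(* Let V be the set of codewords with c_0 = 0.  Give each party the centred
   variance-1 multiple phi_i of its leaked bit.  Expanding the law of L(s) in the
   products phi_S, orthogonal for the product of the marginals, bounds the square
   of the L1 distance by sum_S (E_s phi_S - E_s' phi_S)^2, and the empty S
   contributes 0.  By Fourier inversion |E_s phi_S| is at most the sum of
   prod_(i in S) |phi_i^(a_i)| over the words a orthogonal to V and supported in S.
   The MDS property makes the minimum weight of this dual at least n, so only a = 0
   remains if 0 < |S| < n, and phi_i^(0) = 0.  Otherwise any |S| - n + 1 coordinates
   in S determine a: split off two disjoint sets of that size, use AM-GM and Parseval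
   on them, and bound the other 2n - 2 - |S| factors by the largest Fourier
   coefficient, which is at most 2/3.  Summation over S gives
   dTV^2 <= (4/9)^(2n-2) (13/4)^m, which decays exponentially because
   4n/m >= 2.9984.

   The bound 2/3 needs characteristic at least 7; an MDS code has
   m + 1 - n < p, so p is large when m is.  For a set A of density t, rotating makes
   sum_A chi the sum over A of a function g with the moments of a cosine up to
   order 6, and polynomial majorants of |y| and max(0, y - 2/9) on [-1, 1] give
   (E 1_A g)^2 <= 4/9 t (1 - t). *)
Require Import Defs.
From mathcomp Require Import all_boot all_order all_algebra all_field.
From mathcomp Require Import all_classical all_reals all_analysis.
From mathcomp Require Import fintype finset complex zify ring lra.
Set Implicit Arguments.
Unset Strict Implicit.
Unset Printing Implicit Defensive.
Import Order.TTheory GRing.Theory Num.Theory.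
Import ComplexField.Normc.
Local Open Scope ring_scope.

(** * MDS codes *)

Lemma subset_of_card (T : finType) (B : {set T}) (k : nat) :
  (k <= #|B|)%N -> exists2 A : {set T}, A \subset B & #|A| = k.
Proof.
case/card_geqP => s [us ss sB]; exists [set x in s].
  by apply/subsetP => x; rewrite inE => /sB.
by rewrite cardsE (card_uniqP us).
Qed.

Lemma superset_of_card (T : finType) (B : {set T}) (k : nat) :
  (#|B| <= k <= #|T|)%N -> exists2 A : {set T}, B \subset A & #|A| = k.
Proof.
case/andP=> Bk kT; have [|A sA cA] := @subset_of_card _ (~: B) (k - #|B|).
  by have := cardsC B; lia.
exists (B :|: A); first exact: subsetUl.
rewrite cardsU cA; have -> : B :&: A = finset.set0.
  by apply/eqP; rewrite setI_eq0 disjoint_sym disjoints_subset.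
by rewrite cards0; lia.
Qed.

(** Restriction to [I] is injective on [C] by the MDS property, and [C] has as many elements as
    there are functions on [I], so restriction is also onto. *)
Lemma MDS_interpolation (F : finFieldType) (N : nat) (C : {vspace 'rV[F]_N})
    (I : {set 'I_N}) (y : 'I_N -> F) :
  MDS C -> #|I| = \dim C -> exists2 c, c \in C & {in I, forall i, c 0 i = y i}.
Proof.
move=> mC cI; pose r (c : 'rV[F]_N) := [ffun i => if i \in I then c 0 i else 0].
have rinj : {in [set c in C] &, injective r}.
  move=> c d; rewrite !inE => cC dC /ffunP e; apply: (mC I cI) => // i iI.
  by have := e i; rewrite !ffunE iI.
have sub : r @: [set c in C] \subset pffun_on 0 I predT.
  apply/subsetP => _ /imsetP[c _ ->]; apply/pffun_onP; split=> //.
  by apply/subsetP => i; rewrite inE /= ffunE; case: ifP => //; rewrite eqxx.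
have /subset_cardP-/(_ sub) e : #|r @: [set c in C]| = #|pffun_on (0 : F) I predT|.
  by rewrite card_pffun_on card_in_imset // cardsE card_vspace cI.
have /imsetP[c] : [ffun i => if i \in I then y i else 0] \in r @: [set c in C].
  rewrite e; apply/pffun_onP; split=> //.
  by apply/subsetP => i; rewrite inE /= ffunE; case: ifP => //; rewrite eqxx.
rewrite inE => cC /ffunP ec; exists c => // i iI.
by have := ec i; rewrite !ffunE iI.
Qed.

(** If [a j] were nonzero, a codeword vanishing at coordinate 0 and on the rest of the support of
    [a], with value 1 at [j], would pair with [a] to [a j]. *)
Lemma MDS_dual_weight (F : finFieldType) (m : nat) (C : {vspace 'rV[F]_m.+1})
    (a : 'I_m -> F) : MDS C -> (\dim C <= m.+1)%N ->
  (forall c, c \in sharings C 0 -> \sum_i a i * c 0 (lift ord0 i) = 0) ->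
  (#|[set i | a i != 0%R]| < \dim C)%N -> forall i, a i = 0.
Proof.
move=> mC dC orth wt j; apply/eqP/negP => /negP aj.
pose J := [set lift ord0 i | i in [set i | a i != 0]].
have J0 : ord0 \notin J by apply/imsetP => -[i _ /eqP]; rewrite -(inj_eq val_inj).
have cJ : #|J| = #|[set i | a i != 0]| by rewrite card_imset //; exact: lift_inj.
(* The strict weight bound leaves room for coordinate 0. *)
have [|I sI cI] := @superset_of_card _ (ord0 |: J) (\dim C).
  by rewrite cardsU1 J0 cJ card_ord dC add1n wt.
have [c cC ec] := MDS_interpolation (fun i => (i == lift ord0 j)%:R) mC cI.
have c0 : c 0 ord0 = 0.
  by rewrite ec ?(subsetP sI) ?in_setU1 ?eqxx //= -(inj_eq val_inj).
have := orth c; rewrite inE cC c0 eqxx => /(_ isT) /eqP.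
rewrite (bigD1 j) //= big1 => [|i ij].
  rewrite addr0 ec ?eqxx ?mulr1 ?(negPf aj) //.
  by rewrite (subsetP sI) // in_setU1 imset_f ?orbT // inE.
have [->|ai] := eqVneq (a i) 0; first by rewrite mul0r.
rewrite ec ?(inj_eq lift_inj) ?(negPf ij) ?mulr0 //.
by rewrite (subsetP sI) // in_setU1 imset_f ?orbT // inE.
Qed.

Lemma sharings_neq0 (F : finFieldType) (m : nat) (C : {vspace 'rV[F]_m.+1})
    (s : F) : MDS C -> (0 < \dim C <= m.+1)%N -> (0 < #|sharings C s|)%N.
Proof.
move=> mC dC; have [|I sI cI] := @superset_of_card _ [set (ord0 : 'I_m.+1)] (\dim C).
  by rewrite cards1 card_ord.
have [c cC ec] := MDS_interpolation (fun=> s) mC cI.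
by apply/card_gt0P; exists c; rewrite inE cC ec ?eqxx // (subsetP sI) // set11.
Qed.

(* Fix \dim C - 2 coordinates I and two more, j and l.  Let u and v vanish on I
   and be (1, 0) and (0, 1) on (j, l).  The points (u i : v i), for i outside of I,
   are pairwise distinct on the projective line. *)
Lemma MDS_field_size (F : finFieldType) (N : nat) (C : {vspace 'rV[F]_N}) :
  MDS C -> (1 < \dim C <= N)%N -> (N - \dim C < #|F|)%N.
Proof.
move=> mC /andP[d1 dN].
have [|K _ cK] := @subset_of_card _ [set: 'I_N] (\dim C); first by rewrite cardsT card_ord.
have /card_gt1P[j [l [jK lK jl]]] : (1 < #|K|)%N by rewrite cK.
have [u uC eu] := MDS_interpolation (fun i => (i == j)%:R) mC cK.
have [v vC ev] := MDS_interpolation (fun i => (i == l)%:R) mC cK.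
(* With the common zeros of [u] and [v], [i] and [i'] make [\dim C] zeros of [u - t *: v], whose
   value at [j] is 1. The case [i' = l] serves [t = 0]. *)
have main (i i' : 'I_N) t : i != i' -> (i \notin K) -> (i' \notin K) || (i' == l) ->
    (u - t *: v) 0 i = 0 -> (u - t *: v) 0 i' = 0 -> False.
  move=> ii' iK i'K wi wi'.
  pose I := i |: (i' |: (K :\ j) :\ l).
  have e0 k : k \in I -> (u - t *: v) 0 k = 0.
    rewrite !inE => /orP[/eqP->//|/orP[/eqP->//|/and3P[kl kj kK]]].
    by rewrite !mxE eu // ev // (negPf kj) (negPf kl) mulr0 subr0.
  have cI : #|I| = \dim C.
    have c1 : #|(K :\ j) :\ l| = (\dim C - 2)%N.
      have := cardsD1 j K; rewrite (cardsD1 l (K :\ j)).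
      by rewrite !inE eq_sym jl lK jK cK => ->; rewrite /= addnA addKn.
    have n1 : i' \notin (K :\ j) :\ l.
      by rewrite !inE; case/orP: i'K => [/negPf->|->]; rewrite ?andbF.
    have n2 : i \notin i' |: (K :\ j) :\ l by rewrite !inE (negPf iK) (negPf ii') !andbF.
    by rewrite /I cardsU1 n2 cardsU1 n1 c1 addnA subnKC.
  have /rowP/(_ j) : u - t *: v = 0.
    by apply: (mC I) => //;
      [rewrite rpredB ?rpredZ | rewrite mem0v | move=> k /e0->; rewrite mxE].
  by rewrite !mxE eu // ev // eqxx (negPf jl) mulr0 subr0 => /eqP; rewrite oner_eq0.
have v0 i : i \notin K -> v 0 i != 0.
  move=> iK; apply/eqP => vi.
  pose I := i |: (K :\ l).
  have cI : #|I| = \dim C.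
    by have := cardsD1 l K; rewrite lK cK /I cardsU1 !inE (negPf iK) andbF => ->.
  have /rowP/(_ l) : v = 0.
    apply: (mC I) => //; first by rewrite mem0v.
    move=> k; rewrite !inE mxE => /orP[/eqP->//|/andP[kl kK]].
    by rewrite ev // (negPf kl).
  by rewrite mxE ev // eqxx => /eqP; rewrite oner_eq0.
pose f i := u 0 i / v 0 i.
have finj : {in ~: K &, injective f}.
  move=> i i'; rewrite !inE => iK i'K ff; apply/eqP/negP => /negP ii'.
  apply: (main i i' (f i)) => //; rewrite ?i'K // !mxE.
    by rewrite /f divfK ?subrr ?v0.
  by rewrite ff /f divfK ?subrr ?v0.
(* The value 0 belongs to [l], where (u, v) is (0, 1); that [f] misses it makes the final inequality
   strict. *)
have f0 : 0 \notin f @: ~: K.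
  apply/imsetP => -[i + /esym/eqP]; rewrite inE => iK.
  rewrite /f mulf_eq0 invr_eq0 (negPf (v0 i iK)) orbF => /eqP ui.
  apply: (main i l 0) => //; rewrite ?eqxx ?orbT //.
  - by apply: contraNneq iK => ->.
  - by rewrite !mxE ui mul0r subr0.
  - by rewrite !mxE eu // ev // eq_sym (negPf jl) mul0r subr0.
have cKC : #|~: K| = (N - \dim C)%N by rewrite cardsCs setCK cK card_ord.
by have := max_card (mem (0 |: f @: ~: K)); rewrite cardsU1 f0 card_in_imset ?cKC.
Qed.

(** * Additive characters and Fourier coefficients *)

Lemma normc_ge0 (R : rcfType) (z : R[i]) : 0 <= normc z.
Proof. by case: z => a b; exact: sqrtr_ge0. Qed.

Lemma normc_real (R : rcfType) (x : R) : normc x%:C%C = `|x|.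
Proof. by rewrite /= expr0n addr0 sqrtr_sqr. Qed.

Lemma mul_conjc (R : rcfType) (z : R[i]) : z * conjc z = ((normc z ^+ 2)%:C)%C.
Proof. by rewrite -sqr_normc -[`|z|]/((normc z)%:C)%C rmorphXn. Qed.

Lemma ler_normc_sum (R : rcfType) (I : finType) (P : pred I) (f : I -> R[i]) :
  normc (\sum_(i | P i) f i) <= \sum_(i | P i) normc (f i).
Proof.
elim/big_ind2 : _ => [|x a y b xa yb|//]; first by rewrite normc0.
by apply: le_trans (le_normcD _ _) _; exact: lerD.
Qed.

Lemma normc_prod (R : rcfType) (I : finType) (P : pred I) (f : I -> R[i]) :
  normc (\prod_(i | P i) f i) = \prod_(i | P i) normc (f i).
Proof. by apply: big_morph; [exact: normcM | exact: normc1]. Qed.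

(** Nontriviality is encoded as a vanishing sum, the form that orthogonality uses. *)
Record nt_char (R : rcfType) (F : finFieldType) := NtChar {
  chi_fun :> F -> R[i];
  chi0 : chi_fun 0 = 1;
  chiD : forall x y, chi_fun (x + y) = chi_fun x * chi_fun y;
  sum_chi : \sum_x chi_fun x = 0 }.

Lemma Fp_nt_char (R : rcfType) (p : nat) : prime p -> nt_char R 'F_p.
Proof.
move=> pp; have [w hw] : {w : R[i] | \sum_(i < p) w ^+ i = 0}.
  (* The character is data, so the root [w] of 1 + X + ... + X^(p-1) has to be extracted from an
     existence statement. *)
  apply: cid; have p1 : (0 < p.-1)%N by have := prime_gt1 pp; lia.
  have [w hw] := solve_monicpoly (fun=> (-1 : R[i])) p1; exists w.
  rewrite -(prednK (prime_gt0 pp)) big_ord_recr /= hw -big_split /=.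
  by rewrite big1 // => i _; rewrite mulN1r subrr.
have wp : w ^+ p = 1 by apply/eqP; rewrite -subr_eq0 subrX1 hw mulr0.
exists (fun x : 'F_p => w ^+ x) => [//|x y|].
  have wFp : w ^+ (Zp_trunc (pdiv p)).+2 = 1 by rewrite Fp_cast.
  by rewrite -exprD -[RHS](expr_mod _ wFp).
rewrite -[RHS]hw -(big_mkord predT (fun i => w ^+ i)).
by rewrite -[in RHS](Fp_cast pp) big_mkord.
Qed.

Section Characters.
Context (R : rcfType) (F : finFieldType) (chi : nt_char R F).
Local Notation N := (#|F|%:R : R).

Lemma card_gt0R : 0 < N.
Proof. by rewrite ltr0n; apply/card_gt0P; exists 0. Qed.

Lemma chi_sumE (I : finType) (P : pred I) (f : I -> F) :
  chi (\sum_(i | P i) f i) = \prod_(i | P i) chi (f i).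
Proof. by apply: big_morph; [exact: chiD | exact: chi0]. Qed.

Lemma chiX (x : F) n : chi (x *+ n) = chi x ^+ n.
Proof. by elim: n => [|n IH]; rewrite ?mulr0n ?chi0 // mulrS exprS chiD IH. Qed.

Lemma chiN (x : F) : chi x * chi (- x) = 1.
Proof. by rewrite -chiD subrr chi0. Qed.

(** In characteristic [p] the value [chi x] is a [p]-th root of unity. *)
Lemma normc_chi (x : F) : normc (chi x) = 1.
Proof.
have [p pp cp] := finPcharP F.
have : normc (chi x) ^+ p = 1.
  have -> : normc (chi x) ^+ p = normc (chi x ^+ p).
    by elim: (p) => [|n IH]; rewrite ?normc1 // !exprS normcM IH.
  by rewrite -chiX mulrn_pchar // chi0 normc1.
by move/eqP; rewrite pexpr_eq1 ?normc_ge0 ?prime_gt0 // => /eqP.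
Qed.

Lemma conj_chi (x : F) : conjc (chi x) = chi (- x).
Proof.
have := mul_conjc (chi x); rewrite normc_chi expr1n -[RHS](chiN x).
apply: mulfI; apply/eqP => e; have := normc_chi x; rewrite e normc0 => /eqP.
by rewrite eq_sym oner_eq0.
Qed.

Lemma sum_chiM (z : F) : \sum_a chi (a * z) = (if z == 0 then #|F|%:R else 0).
Proof.
case: eqP => [->|/eqP z0].
  rewrite (eq_bigr (fun=> 1)) => [|a _]; last by rewrite mulr0 chi0.
  by rewrite sumr_const.
by rewrite -[RHS](sum_chi chi) [RHS](reindex_inj (mulIf z0)).
Qed.

(** Dividing by the field size here leaves inversion without a factor and turns the right-hand side
    of Parseval into a mean square. *)
Definition fourier (f : F -> R) (a : F) : R[i] :=
  (N^-1)%:C%C * \sum_x (f x)%:C%C * chi (- (a * x)).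

Lemma fourier_inversion (f : F -> R) (x : F) :
  ((f x)%:C)%C = \sum_a fourier f a * chi (a * x).
Proof.
under eq_bigr do rewrite /fourier -mulrA mulr_suml.
rewrite -mulr_sumr exchange_big /= (bigD1 x) //= [X in _ + X]big1 => [|y yx].
  under eq_bigr do rewrite -mulrA -chiD addNr chi0 mulr1.
  have NC : #|F|%:R = (N%:C)%C by rewrite rmorph_nat.
  rewrite addr0 sumr_const -[X in _ * X]mulr_natr mulrCA NC -rmorphM /= mulVf ?mulr1 //.
  by rewrite gt_eqF // card_gt0R.
under eq_bigr do rewrite -mulrA -chiD addrC -mulrBr.
by rewrite -mulr_sumr sum_chiM subr_eq0 eq_sym (negPf yx) mulr0.
Qed.

Lemma parseval (f : F -> R) :
  \sum_a normc (fourier f a) ^+ 2 = N^-1 * \sum_x f x ^+ 2.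
Proof.
apply: (@complexI R); rewrite !rmorphM !rmorph_sum /=.
under eq_bigr do rewrite -mul_conjc.
have conjE a : conjc (fourier f a) = (N^-1)%:C%C * \sum_x (f x)%:C%C * chi (a * x).
  have cR (x : R) : conjc (x%:C)%C = (x%:C)%C by rewrite /= oppr0.
  have cM (u v : R[i]) : conjc (u * v) = conjc u * conjc v by exact: rmorphM.
  have -> : conjc (fourier f a) = (N^-1)%:C%C * \sum_x conjc ((f x)%:C%C * chi (- (a * x))).
    by rewrite /fourier cM cR; congr (_ * _); exact: (rmorph_sum (@conjc R)).
  by congr (_ * _); apply: eq_bigr => x _; rewrite cM cR conj_chi opprK.
under eq_bigr do rewrite conjE mulrCA mulr_sumr.
rewrite -mulr_sumr exchange_big /=; congr (_ * _); apply: eq_bigr => x _.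
under eq_bigr do rewrite mulrCA.
by rewrite -mulr_sumr -fourier_inversion rmorphXn expr2.
Qed.

End Characters.

(** * Sums over the dual code *)

(** The dual of the shortened code, that is, of [sharings C 0] with coordinate 0 deleted. *)
Definition orth (F : finFieldType) (m : nat) (C : {vspace 'rV[F]_m.+1})
    (a : 'I_m -> F) : bool :=
  [forall c in sharings C 0, \sum_i a i * c 0 (lift ord0 i) == 0].

Lemma orthP (F : finFieldType) (m : nat) (C : {vspace 'rV[F]_m.+1}) (a : 'I_m -> F) :
  reflect (forall c, c \in sharings C 0 -> \sum_i a i * c 0 (lift ord0 i) = 0)
          (orth C a).
Proof. by apply: (iffP forall_inP) => h c /h /eqP. Qed.

(** The sharings of [s] are invariant under translation by [sharings C 0]. If [a] is not orthogonal
    to the latter, some translation multiplies the sum by a value of [chi] other than 1, so the sum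
    is 0. *)
Lemma normc_chi_sharings (R : rcfType) (F : finFieldType) (chi : nt_char R F)
    (m : nat) (C : {vspace 'rV[F]_m.+1}) (s : F) (a : 'I_m -> F) :
  normc (\sum_(c in sharings C s) chi (\sum_i a i * c 0 (lift ord0 i)))
    <= (orth C a)%:R * #|sharings C s|%:R.
Proof.
have [oa|/forallPn[v]] := boolP (orth C a).
  apply: le_trans (ler_normc_sum _ _) _; under eq_bigr do rewrite normc_chi.
  by rewrite sumr_const mul1r.
rewrite negb_imply => /andP[vV v0]; rewrite mul0r.
pose dot (c : 'rV[F]_m.+1) := \sum_i a i * c 0 (lift ord0 i).
have dotZ t : dot (t *: v) = t * dot v.
  by rewrite /dot mulr_sumr; apply: eq_bigr => i _; rewrite mxE mulrCA.
have dotD c d : dot (c + d) = dot c + dot d.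
  by rewrite /dot -big_split; apply: eq_bigr => i _; rewrite mxE mulrDr.
have [t ht] : exists t, chi t != 1.
  apply/existsP; apply: contraT => /existsPn h; have := sum_chi chi.
  rewrite (eq_bigr (fun=> 1)) => [|x _]; last by have /negPn/eqP := h x.
  rewrite sumr_const => /eqP; rewrite pnatr_eq0 -leqn0 leqNgt.
  by rewrite (_ : 0 < _)%N //; apply/card_gt0P; exists 0.
pose w := (t / dot v) *: v.
have dw : dot w = t by rewrite dotZ divfK.
have shift c : (c + w \in sharings C s) = (c \in sharings C s).
  have /andP[vC /eqP ve] : (v \in C) && (v 0 ord0 == 0) by have := vV; rewrite inE.
  by rewrite !inE !mxE ve mulr0 addr0 rpredDr ?rpredZ.
suff -> : \sum_(c in sharings C s) chi (dot c) = 0 by rewrite normc0.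
have : \sum_(c in sharings C s) chi (dot c) =
       chi t * \sum_(c in sharings C s) chi (dot c).
  rewrite [LHS](reindex_inj (addIr w)) /= mulr_sumr (eq_bigl _ _ shift).
  by apply: eq_bigr => c _; rewrite dotD dw chiD mulrC.
move/eqP; rewrite -subr_eq0 -{1}[\sum_(c in _) _]mul1r -mulrBl mulf_eq0 subr_eq0.
by rewrite eq_sym (negPf ht) => /eqP.
Qed.

(** Invert each factor and expand the product: [a] runs over the words supported in [S], and the
    inner character sums discard those outside of the dual. *)
Lemma sharings_fourier (R : rcfType) (F : finFieldType) (chi : nt_char R F)
    (m : nat) (C : {vspace 'rV[F]_m.+1}) (s : F) (S : {set 'I_m})
    (f : 'I_m -> F -> R) :
  `|\sum_(c in sharings C s) \prod_(i in S) f i (c 0 (lift ord0 i))|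
    <= #|sharings C s|%:R *
       \sum_(a in pffun_on (0 : F) (mem S) predT | orth C a)
         \prod_(i in S) normc (fourier chi (f i) (a i)).
Proof.
rewrite -normc_real rmorph_sum /=.
have -> : \sum_(c in sharings C s)
    ((\prod_(i in S) f i (c 0 (lift ord0 i)))%:C)%C =
  \sum_(a in pffun_on (0 : F) (mem S) predT)
    (\prod_(i in S) fourier chi (f i) (a i)) *
    \sum_(c in sharings C s) chi (\sum_i a i * c 0 (lift ord0 i)).
  under [RHS]eq_bigr do rewrite mulr_sumr.
  rewrite [RHS]exchange_big /=; apply: eq_bigr => c _; rewrite rmorph_prod /=.
  under eq_bigr do rewrite (fourier_inversion chi).
  rewrite (big_distr_big (0 : F)) /=; apply: eq_bigr => a /pffun_onP[/subsetP sa _].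
  rewrite big_split /=; congr (_ * _); rewrite -chi_sumE; congr (chi _).
  rewrite [RHS](bigID (mem S)) /= [X in _ + X]big1 ?addr0 // => i iS.
  suff -> : a i = 0 by rewrite mul0r.
  by apply/eqP; apply: contraNT iS => /sa.
apply: le_trans (ler_normc_sum _ _) _; rewrite mulr_sumr big_mkcondr /=.
apply: ler_sum => a _; rewrite normcM normc_prod.
apply: le_trans (ler_wpM2l _ (normc_chi_sharings _ _ _ _)) _.
  by apply: prodr_ge0 => i _; exact: normc_ge0.
by case: ifP; rewrite ?mul0r ?mulr0 // mul1r mulrC.
Qed.

Section DualSum.
Context (R : realFieldType) (F : finFieldType) (m : nat) (C : {vspace 'rV[F]_m.+1}).
Hypothesis (mC : MDS C) (dC : (0 < \dim C <= m.+1)%N).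
(** [w i a] stands for the modulus of the Fourier coefficient at [a] of the normalised bit of party
    [i]; [k] will be 2/3. *)
Variables (S : {set 'I_m}) (w : 'I_m -> F -> R) (k : R).
Hypotheses (w0 : forall i a, 0 <= w i a) (wz : forall i, w i 0 = 0)
  (w2 : forall i, \sum_a w i a ^+ 2 <= 1) (wk : forall i a, w i a <= k).

Let D := [pred a : {ffun 'I_m -> F} | (a \in pffun_on (0 : F) (mem S) predT) && orth C a].

Lemma orthB (a b : {ffun 'I_m -> F}) : orth C a -> orth C b ->
  orth C (fun i => a i - b i).
Proof.
move=> /orthP oa /orthP ob; apply/orthP => c cV.
by under eq_bigr do rewrite mulrBl; rewrite sumrB oa // ob // subr0.
Qed.

Lemma dual_sum_eq0 : (0 < #|S| < \dim C)%N ->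
  \sum_(a in D) \prod_(i in S) w i (a i) = 0.
Proof.
case/andP=> S0 Sn; apply: big1 => a /andP[/pffun_onP[/subsetP sa _] /orthP oa].
have /card_gt0P[i iS] := S0; rewrite (bigD1 i) //=.
have -> : a i = 0.
  have := @MDS_dual_weight _ _ _ a mC; apply=> //; first by case/andP: dC.
  apply: leq_ltn_trans Sn; apply/subset_leq_card/subsetP => j; rewrite inE.
  by move/sa.
by rewrite wz mul0r.
Qed.

(** Two words of [D] that agree on [T] differ in fewer than [\dim C] places, so they are equal.
    Restriction to [T] is thus injective on [D], and the sum over all words on [T] factors into sums
    that [w2] bounds. *)
Lemma dual_sum_sqr_le1 (T : {set 'I_m}) : T \subset S -> (#|S :\: T| < \dim C)%N ->
  \sum_(a in D) \prod_(i in T) w i (a i) ^+ 2 <= 1.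
Proof.
move=> TS cT.
pose r (a : {ffun 'I_m -> F}) := [ffun i => if i \in T then a i else 0] : {ffun 'I_m -> F}.
have rinj : {in D &, injective r}.
  move=> a b /andP[/pffun_onP[/subsetP sa _] oa] /andP[/pffun_onP[/subsetP sb _] ob] e.
  apply/ffunP => j; apply/eqP; rewrite -subr_eq0; apply/eqP.
  have := @MDS_dual_weight _ _ _ (fun i => a i - b i) mC; apply=> //.
  - by case/andP: dC.
  - by apply/orthP/orthB.
  apply: leq_ltn_trans cT; apply/subset_leq_card/subsetP => i; rewrite !inE subr_eq0.
  move=> ab; apply/andP; split.
    by apply: contra ab => iT; have /ffunP/(_ i) := e; rewrite !ffunE iT => ->.
  have [a0|/sa//] := eqVneq (a i) 0; apply: sb.
  by rewrite inE /= -a0 eq_sym.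
have -> : \sum_(a in D) \prod_(i in T) w i (a i) ^+ 2 =
          \sum_(a in D) \prod_(i in T) w i (r a i) ^+ 2.
  by apply: eq_bigr => a _; apply: eq_bigr => i iT; rewrite ffunE iT.
rewrite -(big_imset (fun b : {ffun 'I_m -> F} => \prod_(i in T) w i (b i) ^+ 2) rinj) /=.
apply: (@le_trans _ _ (\sum_(b in pffun_on (0 : F) (mem T) predT)
    \prod_(i in T) w i (b i) ^+ 2)).
  rewrite [leRHS](bigID (mem (r @: D))) /= -[leLHS]addr0 lerD //.
    rewrite le_eqVlt; apply/orP; left; apply/eqP; apply: eq_bigl => b.
    apply/idP/andP => [br|[]//]; split=> //; have /imsetP[a _ ->] := br.
    apply/pffun_onP; split=> //; apply/subsetP => i; rewrite inE /= ffunE.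
    by case: ifP => //; rewrite eqxx.
  by apply: sumr_ge0 => b _; apply: prodr_ge0 => i _; exact: sqr_ge0.
rewrite -(big_distr_big (0 : F) (mem T) predT (fun i a => w i a ^+ 2)) /=.
by apply: prodr_ile1 => i _; rewrite w2 sumr_ge0 // => a _; exact: sqr_ge0.
Qed.

Lemma dual_sum_le : (\dim C <= #|S|)%N -> (#|S| + 2 <= 2 * \dim C)%N ->
  \sum_(a in D) \prod_(i in S) w i (a i) <= k ^+ (2 * \dim C - 2 - #|S|).
Proof.
(* [d] is the least size of a [T] for which [S :\: T] has fewer than [\dim C] elements; two disjoint
   sets of this size fit into [S]. *)
move=> nS Sn; set d := (#|S| - (\dim C - 1))%N.
have /card_gt0P[i0 _] : (0 < #|S|)%N by apply: leq_trans nS; case/andP: dC.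
have k0 : 0 <= k by apply: le_trans (wk i0 0).
have [|T1 T1S c1] := @subset_of_card _ S d; first by rewrite leq_subr.
have cS1 : #|S :\: T1| = (\dim C - 1)%N.
  by rewrite cardsD (setIidPr T1S) c1 /d; lia.
have [|T2 T2S c2] := @subset_of_card _ (S :\: T1) d; first by rewrite cS1 /d; lia.
have T2S' : T2 \subset S := subset_trans T2S (subsetDl _ _).
have cS2 : #|S :\: T2| = (\dim C - 1)%N.
  by rewrite cardsD (setIidPr T2S') c2 /d; lia.
set r := (2 * \dim C - 2 - #|S|)%N.
have cR : #|(S :\: T1) :\: T2| = r.
  by rewrite cardsD (setIidPr T2S) c2 cS1 /d /r; lia.
have n1 : (\dim C - 1 < \dim C)%N by lia.
apply: (@le_trans _ _ (\sum_(a in D) k ^+ r *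
   ((\prod_(i in T1) w i (a i) ^+ 2 + \prod_(i in T2) w i (a i) ^+ 2) / 2))).
  apply: ler_sum => a _.
  rewrite (big_setID T1) /= (setIidPr T1S) [X in _ * X](big_setID T2) /= (setIidPr T2S).
  have A0 : 0 <= \prod_(i in T1) w i (a i) by apply: prodr_ge0.
  have B0 : 0 <= \prod_(i in T2) w i (a i) by apply: prodr_ge0.
  have Rk : \prod_(i in (S :\: T1) :\: T2) w i (a i) <= k ^+ r.
    by rewrite -cR -prodr_const; apply: ler_prod => i _; rewrite w0 wk.
  rewrite mulrA mulrC !prodrXl; set A := (\prod_(i in T1) _) in A0 *.
  set B := (\prod_(i in T2) _) in B0 *.
  apply: (le_trans (ler_wpM2r (mulr_ge0 A0 B0) Rk)).
  apply: ler_wpM2l; first exact: exprn_ge0.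
  have := sqr_ge0 (A - B); rewrite sqrrB. lra.
rewrite -mulr_sumr -mulr_suml big_split /=.
have := dual_sum_sqr_le1 T1S; rewrite cS1 => /(_ n1) h1.
have := dual_sum_sqr_le1 T2S'; rewrite cS2 => /(_ n1) h2.
rewrite -[leRHS]mulr1; apply: ler_wpM2l; first exact: exprn_ge0.
by rewrite ler_pdivrMr ?ltr0n // mul1r; lra.
Qed.

End DualSum.

(** * Fourier coefficients of subsets *)

(* The right-hand side touches |y| at the zeros 1/3 and 1 of u^2 - 4/3 u + 1/3. *)
Lemma ler_abs_sextic (R : realFieldType) (y : R) :
  `|y| <= (19 + 235 * y ^+ 2 + - 207 * y ^+ 4 + 81 * y ^+ 6) / 128.
Proof.
have e n : y ^+ n.*2 = `|y| ^+ n.*2 by rewrite -mul2n !exprM real_normK ?num_real.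
rewrite (e 1%N) (e 2%N) (e 3%N) -subr_ge0; set u := `|y|.
have -> : (19 + 235 * u ^+ 1.*2 + - 207 * u ^+ 2.*2 + 81 * u ^+ 3.*2) / 128 - u =
   81 / 128 * (u ^+ 2 - 4 / 3 * u + 1 / 3) ^+ 2 * (u ^+ 2 + 8 / 3 * u + 19 / 9).
  by rewrite /=; field.
have u0 : 0 <= u by exact: normr_ge0.
by apply: mulr_ge0; [apply: mulr_ge0; [lra | exact: sqr_ge0] | nra].
Qed.

(* This quartic majorant of max(0, y - 2/9) vanishes at -1/3 and touches y - 2/9 at
   7/9. *)
Lemma quartic_ge0 (R : realFieldType) (y : R) : -1 <= y <= 1 ->
  0 <= (207 + 1368 * y + 2538 * y ^+ 2 + 648 * y ^+ 3 + - 729 * y ^+ 4) / 5120.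
Proof.
move=> /andP[y1 y2].
have -> : (207 + 1368 * y + 2538 * y ^+ 2 + 648 * y ^+ 3 + - 729 * y ^+ 4) / 5120 =
  9 / 5120 * (3 * y + 1) ^+ 2 * ((y + 1) * (23 - 9 * y)) by field.
by apply: mulr_ge0; [apply: mulr_ge0; [lra | exact: sqr_ge0] | apply: mulr_ge0; lra].
Qed.

Lemma quartic_ge (R : realFieldType) (y : R) : -1 <= y <= 1 ->
  y - 2 / 9 <= (207 + 1368 * y + 2538 * y ^+ 2 + 648 * y ^+ 3 + - 729 * y ^+ 4) / 5120.
Proof.
move=> /andP[y1 y2]; rewrite -subr_ge0.
have -> : (207 + 1368 * y + 2538 * y ^+ 2 + 648 * y ^+ 3 + - 729 * y ^+ 4) / 5120 -
  (y - 2 / 9) = 1 / 5120 / 9 * (9 * y - 7) ^+ 2 * (247 - 54 * y - 81 * y ^+ 2) by field.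
by apply: mulr_ge0; [apply: mulr_ge0; [lra | exact: sqr_ge0] | nra].
Qed.

(** [P] dominates max(0, g - l), so extending the sum of [P] from [A] to [X] only increases it; [l]
    acts as a multiplier for the size of [A]. *)
Lemma subset_sum_le (R : realFieldType) (X : finType) (A : {set X}) (g P : X -> R) (l : R) :
  (forall x, 0 <= P x) -> (forall x, g x - l <= P x) ->
  \sum_(x in A) g x <= l * #|A|%:R + \sum_x P x.
Proof.
move=> P0 gP; rewrite [X in _ + X](bigID (mem A)) /= addrA -[leLHS]addr0.
apply: lerD; last exact: sumr_ge0.
rewrite mulr_natr -sumr_const -big_split /=; apply: ler_sum => x _.
by rewrite -lerBlDl gP.
Qed.

Lemma sum_const_mul (R : realFieldType) (X : finType) (c : R) :
  \sum_(x : X) c = c * #|X|%:R.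
Proof. by rewrite sumr_const mulr_natr. Qed.

(** Here [l] is 0 and max(0, g) = (g + |g|) / 2, with the sextic in place of |g|. The moments give
    1347/4096, rounded up to 329/1000. *)
Lemma subset_sum_sextic (R : realFieldType) (X : finType) (A : {set X}) (g : X -> R) :
  let N := #|X|%:R in
  \sum_x g x = 0 -> \sum_x g x ^+ 2 = N / 2 -> \sum_x g x ^+ 4 = 3 * N / 8 ->
  \sum_x g x ^+ 6 = 5 * N / 16 -> \sum_(x in A) g x <= 329 / 1000 * N.
Proof.
move=> N e1 e2 e4 e6; have N0 : 0 <= N by exact: ler0n.
apply: (@le_trans _ _ (0 * #|A|%:R + \sum_x (g x +
    (19 + 235 * g x ^+ 2 + - 207 * g x ^+ 4 + 81 * g x ^+ 6) / 128) / 2)).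
  apply: subset_sum_le => x; move: (ler_abs_sextic (g x));
    have := ler_norm (g x); have := ler_norm (- g x); rewrite normrN;
    set q := (_ / 128); by clear; lra.
rewrite -mulr_suml big_split /= e1 -mulr_suml !big_split /= sum_const_mul.
by rewrite -!mulr_sumr e2 e4 e6 -/N; clear - N0; lra.
Qed.

Lemma subset_sum_quartic (R : realFieldType) (X : finType) (A : {set X}) (g : X -> R) :
  let N := #|X|%:R in
  (forall x, -1 <= g x <= 1) -> \sum_x g x = 0 -> \sum_x g x ^+ 2 = N / 2 ->
  \sum_x g x ^+ 3 = 0 -> \sum_x g x ^+ 4 = 3 * N / 8 ->
  \sum_(x in A) g x <= 2 / 9 * #|A|%:R + 47 / 200 * N.
Proof.
move=> N g1 e1 e2 e3 e4; have N0 : 0 <= N by exact: ler0n.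
apply: (@le_trans _ _ (2 / 9 * #|A|%:R + \sum_x (207 + 1368 * g x +
    2538 * g x ^+ 2 + 648 * g x ^+ 3 + - 729 * g x ^+ 4) / 5120)).
  by apply: subset_sum_le => x; [exact: quartic_ge0 | exact: quartic_ge].
rewrite -mulr_suml !big_split /= sum_const_mul -!mulr_sumr e1 e2 e3 e4 -/N lerD2l.
by clear - N0; lra.
Qed.

Lemma three_lines_le_parabola (R : realFieldType) (M a N : R) :
  0 <= M -> 0 <= a -> 0 <= N -> 2 * a <= N ->
  M <= a -> M <= 329 / 1000 * N -> M <= 2 / 9 * a + 47 / 200 * N ->
  M ^+ 2 <= 4 / 9 * a * (N - a).
Proof.
move=> M0 a0 N0 hA b1 b2 b3.
have sq t : M <= t -> M ^+ 2 <= t ^+ 2.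
  by move=> h; rewrite ler_pXn2r // nnegrE; apply: le_trans h.
have NN : 0 <= N * N by exact: mulr_ge0.
(* [a = 4 / 13 * N] is where [a ^+ 2] meets the parabola. *)
have [h|h] := leP a (4 / 13 * N).
  have := sq _ b1; have : 0 <= a * (4 / 13 * N - a) by apply: mulr_ge0 => //; lra.
  by rewrite !expr2; clear; lra.
(* 21/50 lies just above the smaller root t of (329/1000)^2 = 4/9 t (1 - t). *)
have [h'|h'] := leP (21 / 50 * N) a.
  have : 0 <= (a - 21 / 50 * N) * (29 / 50 * N - a) by apply: mulr_ge0; lra.
  by have := sq _ b2; rewrite !expr2; clear - NN; lra.
(* The parabola minus the square of the third bound is concave in [a], so nonnegativity at the two
   endpoints suffices. *)
have : 0 <= (a - 4 / 13 * N) * (21 / 50 * N - a) by apply: mulr_ge0; lra.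
have := sq _ b3.
have : 0 <= N * (a - 4 / 13 * N) by apply: mulr_ge0; lra.
have : 0 <= N * (21 / 50 * N - a) by apply: mulr_ge0; lra.
by rewrite !expr2; clear - NN; lra.
Qed.

(* The hypotheses on g say that it has the moments of the cosine of a uniform
   angle up to order 6. *)
Lemma subset_sum_sqr (R : realFieldType) (X : finType) (A : {set X}) (g : X -> R) :
  let N := #|X|%:R in
  (forall x, -1 <= g x <= 1) -> \sum_x g x = 0 -> \sum_x g x ^+ 2 = N / 2 ->
  \sum_x g x ^+ 3 = 0 -> \sum_x g x ^+ 4 = 3 * N / 8 ->
  \sum_x g x ^+ 6 = 5 * N / 16 -> (2 * #|A| <= #|X|)%N -> 0 <= \sum_(x in A) g x ->
  (\sum_(x in A) g x) ^+ 2 <= 4 / 9 * #|A|%:R * (N - #|A|%:R).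
Proof.
move=> N g1 e1 e2 e3 e4 e6 hA M0; apply: three_lines_le_parabola => //.
- by rewrite -natrM ler_nat.
- by rewrite -sum1_card natr_sum; apply: ler_sum => x _; case/andP: (g1 x).
- exact: subset_sum_sextic.
- exact: subset_sum_quartic.
Qed.

Lemma ReD (R : rcfType) (x y : R[i]) : complex.Re (x + y) = complex.Re x + complex.Re y.
Proof. by case: x => ? ?; case: y. Qed.

Lemma Re_sum (R : rcfType) (I : finType) (P : pred I) (f : I -> R[i]) :
  complex.Re (\sum_(i | P i) f i) = \sum_(i | P i) complex.Re (f i).
Proof. by apply: (big_morph (@complex.Re R)) => //; exact: ReD. Qed.

Lemma normc1_sqr (R : rcfType) (a b : R) : normc (a +i* b)%C = 1 -> b ^+ 2 = 1 - a ^+ 2.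
Proof.
move=> /= h; apply/eqP; rewrite eq_sym subr_eq addrC eq_sym; apply/eqP.
by rewrite -[LHS]sqr_sqrtr ?h ?expr1n // addr_ge0 ?sqr_ge0.
Qed.

(** The Chebyshev polynomial of degree 2. Composed with itself and with the cubic one of
    [Re_cube_unit], it yields degrees 4 and 6. *)
Lemma Re_sqr_unit (R : rcfType) (z : R[i]) : normc z = 1 ->
  complex.Re (z ^+ 2) = 2 * complex.Re z ^+ 2 - 1.
Proof. by case: z => a b /normc1_sqr h; rewrite expr2 /=; lra. Qed.

Lemma Re_cube_unit (R : rcfType) (z : R[i]) : normc z = 1 ->
  complex.Re (z ^+ 3) = 4 * complex.Re z ^+ 3 - 3 * complex.Re z.
Proof. by case: z => a b /normc1_sqr h; rewrite exprS expr2 /=; ring: h. Qed.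

Lemma Re_unit_bound (R : rcfType) (z : R[i]) : normc z = 1 -> -1 <= complex.Re z <= 1.
Proof.
case: z => a b /normc1_sqr h /=; rewrite -ler_norml -(@ler_pXn2r _ 2) ?nnegrE //.
by rewrite real_normK ?num_real // expr1n; have := sqr_ge0 b; lra.
Qed.

Section SubsetBias.
Context (R : rcfType) (F : finFieldType) (chi : nt_char R F).
Hypothesis charF : forall k, (0 < k < 7)%N -> k%:R != 0 :> F.

(** A rotation [u] makes the sum real, hence a sum of the cosines [g x]. Their moments follow from
    the vanishing power sums of [w] through the Chebyshev polynomials. *)
Lemma normc_subset_half (A : {set F}) (a : F) : a != 0 -> (2 * #|A| <= #|F|)%N ->
  normc (\sum_(x in A) chi (- (a * x))) ^+ 2
    <= 4 / 9 * #|A|%:R * (#|F|%:R - #|A|%:R).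
Proof.
move=> a0 hA; set z := \sum_(x in A) _.
have [->|z0] := eqVneq z 0.
  rewrite normc0 expr0n /= !mulr_ge0 ?divr_ge0 ?ler0n //.
  by rewrite subr_ge0 ler_nat; exact: max_card.
have nz : normc z != 0 by apply: contra z0 => /eqP /eq0_normc ->.
(* The inverse phase of [z]. *)
pose u := conjc z * ((normc z)^-1)%:C%C.
have uz : u * z = (normc z)%:C%C.
  rewrite /u mulrAC [conjc z * z]mulrC mul_conjc -rmorphM /=; congr (_%:C%C).
  by rewrite expr2 mulfK.
have u1 : normc u = 1.
  by apply: (mulIf nz); rewrite mul1r -normcM uz normc_real ger0_norm // normc_ge0.
pose w x := u * chi (- (a * x)); pose g x := complex.Re (w x).
have w1 x : normc (w x) = 1 by rewrite normcM u1 normc_chi mulr1.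
(* The powers of [w] are again character sums, with frequency [a *+ k], which [charF] keeps
   nonzero. *)
have wk k : (0 < k < 7)%N -> \sum_x w x ^+ k = 0.
  move=> hk; have E x : w x ^+ k = u ^+ k * chi (x * - (a *+ k)).
    by rewrite exprMn -chiX; congr (_ * chi _); rewrite mulNrn -mulrnAl mulrN [x * _]mulrC.
  under eq_bigr do rewrite E.
  have ak : a *+ k != 0 by rewrite -mulr_natr mulf_neq0 ?charF.
  by rewrite -mulr_sumr sum_chiM oppr_eq0 (negPf ak) mulr0.
have Rk k : (0 < k < 7)%N -> \sum_x complex.Re (w x ^+ k) = 0.
  by move=> hk; rewrite -Re_sum wk.
have cst (c : R) : \sum_(x : F) c = c * #|F|%:R by rewrite sumr_const mulr_natr.
have e1 : \sum_x g x = 0 by rewrite -[RHS](Rk 1%N) //.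
have e2 : \sum_x g x ^+ 2 = #|F|%:R / 2.
  have := Rk 2%N isT; under eq_bigr do rewrite Re_sqr_unit //.
  by rewrite sumrB -mulr_sumr cst => h; rewrite /g; lra.
have e3 : \sum_x g x ^+ 3 = 0.
  have := Rk 3%N isT; under eq_bigr do rewrite Re_cube_unit //.
  by rewrite sumrB -!mulr_sumr -/g => h; have := e1; rewrite /g; lra.
have wX x k : normc (w x ^+ k) = 1.
  by elim: k => [|k IH]; rewrite ?normc1 // exprS normcM IH w1 mulr1.
have e4 : \sum_x g x ^+ 4 = 3 * #|F|%:R / 8.
  have := Rk 4%N isT.
  have E x : complex.Re (w x ^+ 4) = 8 * g x ^+ 4 + (- 8 * g x ^+ 2 + 1).
    by rewrite (exprM _ 2 2) Re_sqr_unit // Re_sqr_unit // -/(g x); ring.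
  under eq_bigr do rewrite E.
  by rewrite !big_split /= -!mulr_sumr cst e2; lra.
have e6 : \sum_x g x ^+ 6 = 5 * #|F|%:R / 16.
  have := Rk 6%N isT.
  have E x : complex.Re (w x ^+ 6) =
      32 * g x ^+ 6 + (- 48 * g x ^+ 4 + (18 * g x ^+ 2 + -1)).
    by rewrite (exprM _ 2 3) Re_cube_unit // Re_sqr_unit // -/(g x); ring.
  under eq_bigr do rewrite E.
  by rewrite !big_split /= -!mulr_sumr cst e2 e4; lra.
have gz : \sum_(x in A) g x = normc z.
  by rewrite -Re_sum -mulr_sumr uz.
rewrite -gz; apply: subset_sum_sqr => //; last by rewrite gz normc_ge0.
by move=> x; exact: Re_unit_bound.
Qed.

(** Passing to the complement only changes the sign of the sum, and the bound is symmetric under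
    it. *)
Lemma normc_subset (A : {set F}) (a : F) : a != 0 ->
  normc (\sum_(x in A) chi (- (a * x))) ^+ 2
    <= 4 / 9 * #|A|%:R * (#|F|%:R - #|A|%:R).
Proof.
move=> a0; have [|hA] := leqP (2 * #|A|) #|F|; first exact: normc_subset_half.
have cA : #|~: A|%:R = #|F|%:R - #|A|%:R :> R.
  by rewrite -(cardsC A) natrD addrC addKr.
have sA : \sum_(x in A) chi (- (a * x)) = - \sum_(x in ~: A) chi (- (a * x)).
  apply/eqP; rewrite -addr_eq0; apply/eqP.
  have -> : \sum_(x in ~: A) chi (- (a * x)) = \sum_(x | x \notin A) chi (- (a * x)).
    by apply: eq_bigl => x; rewrite inE.
  have : \sum_x chi (- (a * x)) = 0.
    under eq_bigr => x _ do rewrite mulrC -mulrN.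
    by rewrite sum_chiM oppr_eq0 (negPf a0).
  by rewrite (bigID (mem A)).
have := @normc_subset_half (~: A) a a0; rewrite cA sA normcN.
have -> : #|F|%:R - (#|F|%:R - #|A|%:R) = #|A|%:R :> R by ring.
rewrite mulrAC; apply => //; move: hA; rewrite -!(cardsC A).
by move: #|A| #|~: A| => x y; clear; lia.
Qed.

End SubsetBias.

(** * The chi-square expansion *)

(* The products of the phi i are orthogonal in L2 of the product measure. *)
Lemma l1_sqr_le (R : realFieldType) (I T : finType) (pr phi : I -> T -> R)
    (d : {set I} -> R) :
  (forall i t, 0 <= pr i t) -> (forall i, \sum_t pr i t = 1) ->
  (forall i, \sum_t pr i t * phi i t = 0) ->
  (forall i, \sum_t pr i t * phi i t ^+ 2 <= 1) ->
  (\sum_(t : {ffun I -> T}) `|(\prod_i pr i (t i)) *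
     \sum_(S : {set I}) d S * \prod_(i in S) phi i (t i)|) ^+ 2
    <= \sum_(S : {set I}) d S ^+ 2.
Proof.
move=> pr0 pr1 ph1 ph2.
pose Q (t : {ffun I -> T}) := \prod_i pr i (t i).
pose G (t : {ffun I -> T}) := \sum_(S : {set I}) d S * \prod_(i in S) phi i (t i).
have Q0 t : 0 <= Q t by exact: prodr_ge0.
have Q1 : \sum_t Q t = 1.
  by rewrite -(bigA_distr_bigA pr) big1.
under eq_bigr => t _ do rewrite normrM (ger0_norm (Q0 t)) -/(G t).
set M := \sum_t _.
(* [Q] is a probability, so a nonnegative variance of |G| replaces Cauchy-Schwarz. *)
have var : 0 <= \sum_t Q t * (`|G t| - M) ^+ 2.
  by apply: sumr_ge0 => t _; rewrite mulr_ge0 ?sqr_ge0.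
have varE : \sum_t Q t * (`|G t| - M) ^+ 2 = \sum_t Q t * G t ^+ 2 - M ^+ 2.
  have E t : Q t * (`|G t| - M) ^+ 2 =
      Q t * G t ^+ 2 + (- (2 * M) * (Q t * `|G t|) + M ^+ 2 * Q t).
    by rewrite -[G t ^+ 2]real_normK ?num_real //; ring.
  under eq_bigr do rewrite E.
  by rewrite !big_split /= -!mulr_sumr Q1 -/M; ring.
have {var varE} : M ^+ 2 <= \sum_t Q t * G t ^+ 2 by rewrite -subr_ge0 -varE.
move/le_trans; apply.
pose e (S : {set I}) i t : R := if i \in S then phi i t else 1.
have prodE (S : {set I}) (t : {ffun I -> T}) :
    \prod_(i in S) phi i (t i) = \prod_i e S i (t i).
  by rewrite big_mkcond.
have ortho (S S' : {set I}) :
    \sum_t Q t * (\prod_i e S i (t i) * \prod_i e S' i (t i)) <= (S == S')%:R /\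
    (S != S' -> \sum_t Q t * (\prod_i e S i (t i) * \prod_i e S' i (t i)) = 0).
  have -> : \sum_t Q t * (\prod_i e S i (t i) * \prod_i e S' i (t i)) =
            \prod_i \sum_t pr i t * (e S i t * e S' i t).
    by rewrite bigA_distr_bigA /=; apply: eq_bigr => t _; rewrite -!big_split.
  have [->|SS'] := eqVneq S S'.
    split=> //; apply: prodr_ile1 => i _; apply/andP; split.
      by apply: sumr_ge0 => t _; rewrite mulr_ge0 // -expr2 sqr_ge0.
    rewrite /e; case: (i \in S'); first exact: ph2.
    by under eq_bigr do rewrite !mulr1; rewrite pr1.
  suff -> : \prod_i \sum_t pr i t * (e S i t * e S' i t) = 0 by [].
  have [i iSS'] : exists i, (i \in S) != (i \in S').
    apply/existsP; apply: contraT => /existsPn h.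
    by case/negP: SS'; apply/eqP/setP => i; have /negPn/eqP := h i.
  rewrite (bigD1 i) //=.
  have -> : \sum_t pr i t * (e S i t * e S' i t) = 0; last by rewrite mul0r.
  rewrite -[RHS](ph1 i); apply: eq_bigr => t _; congr (_ * _); rewrite /e.
  by case: (i \in S) (i \in S') iSS' => [] [] //=; rewrite ?mulr1 ?mul1r.
have -> : \sum_t Q t * G t ^+ 2 = \sum_(S : {set I}) \sum_(S' : {set I})
    d S * d S' * \sum_t Q t * (\prod_i e S i (t i) * \prod_i e S' i (t i)).
  transitivity (\sum_t \sum_(S : {set I}) \sum_(S' : {set I})
    d S * d S' * (Q t * (\prod_i e S i (t i) * \prod_i e S' i (t i)))).
    apply: eq_bigr => t _; rewrite expr2 /G mulr_suml mulr_sumr.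
    apply: eq_bigr => S _; rewrite !mulr_sumr; apply: eq_bigr => S' _.
    by rewrite !prodE; ring.
  rewrite exchange_big; apply: eq_bigr => S _; rewrite exchange_big.
  by apply: eq_bigr => S' _; rewrite mulr_sumr.
apply: ler_sum => S _; rewrite (bigD1 S) //= [X in _ + X]big1 => [|S' SS'].
  have [h _] := ortho S S; rewrite eqxx in h.
  by rewrite addr0 -expr2 -[leRHS]mulr1 ler_wpM2l ?sqr_ge0.
by have [_ ->] := ortho S S'; rewrite ?mulr0 // eq_sym.
Qed.

Fact sp1_subproof : (1 : int) \in [:: -1; 1 : int]. Proof. by []. Qed.
Fact sm1_subproof : (-1 : int) \in [:: -1; 1 : int]. Proof. by []. Qed.
Definition sp1 : sign := SeqSub sp1_subproof.
Definition sm1 : sign := SeqSub sm1_subproof.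

Lemma signE (t : sign) : (t == sp1) = (t != sm1).
Proof. by case: t => x xs; rewrite -!val_eqE /=; move: xs; rewrite !inE => /orP[] /eqP ->. Qed.

Lemma sum_sign (R : nmodType) (G : sign -> R) : \sum_t G t = G sp1 + G sm1.
Proof.
rewrite (bigD1 sp1) //=; congr (_ + _); apply: big_pred1 => t.
by rewrite signE negbK.
Qed.

Section OneBit.
Context (R : rcfType) (F : finFieldType) (g : F -> sign).

Definition prb (t : sign) : R := #|[set x | g x == t]|%:R / #|F|%:R.

(* phib \o g is g, centred and normalised to variance 1.  If g is constant, phib is
   0, because x / 0 = 0. *)
Definition phib (t : sign) : R :=
  if t == sp1 then Num.sqrt (prb sm1 / prb sp1) else - Num.sqrt (prb sp1 / prb sm1).

Lemma prb_ge0 t : 0 <= prb t. Proof. by rewrite divr_ge0 ?ler0n. Qed.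

Lemma prb_gt0 x : 0 < prb (g x).
Proof.
rewrite divr_gt0 ?(card_gt0R R F) // ltr0n; apply/card_gt0P; exists x.
by rewrite inE.
Qed.

Lemma prb_avg (f : sign -> R) : #|F|%:R^-1 * \sum_x f (g x) = \sum_t prb t * f t.
Proof.
rewrite mulr_sumr (partition_big g predT) //=; apply: eq_bigr => t _.
rewrite (eq_bigr (fun=> #|F|%:R^-1 * f t)) => [|x /eqP-> //].
rewrite sumr_const -[LHS]mulr_natl mulrA /prb; congr (_%:R * _ * _).
by apply: eq_card => x; rewrite !inE.
Qed.

Lemma prb_sum : prb sp1 + prb sm1 = 1.
Proof.
have := prb_avg (fun=> 1); rewrite sum_sign !mulr1 => <-.
by rewrite sumr_const mulVf // gt_eqF // (card_gt0R R F).
Qed.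

Lemma phib_sp1 : phib sp1 = Num.sqrt (prb sm1 / prb sp1).
Proof. by rewrite /phib eqxx. Qed.

Lemma phib_sm1 : phib sm1 = - Num.sqrt (prb sp1 / prb sm1).
Proof. by []. Qed.

Lemma phib_degenerate : prb sp1 = 0 \/ prb sm1 = 0 -> forall t, phib t = 0.
Proof.
move=> h t; rewrite /phib; have -> : prb sm1 / prb sp1 = 0.
  by case: h => ->; rewrite ?invr0 ?mul0r ?mulr0.
have -> : prb sp1 / prb sm1 = 0 by case: h => ->; rewrite ?invr0 ?mul0r ?mulr0.
by rewrite sqrtr0 oppr0; case: ifP.
Qed.

Lemma phib_regular : prb sp1 != 0 -> prb sm1 != 0 ->
  [/\ prb sp1 * phib sp1 ^+ 2 = prb sm1, prb sm1 * phib sm1 ^+ 2 = prb sp1 &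
      phib sp1 * phib sm1 = -1].
Proof.
move=> a0 b0; rewrite phib_sp1 phib_sm1 sqrrN !sqr_sqrtr ?divr_ge0 ?prb_ge0 //.
split; [by field | by field | rewrite mulrN -sqrtrM ?divr_ge0 ?prb_ge0 //].
by rewrite (_ : _ * _ = 1) ?sqrtr1 //; field; rewrite a0 b0.
Qed.

Lemma prb_phib1 : \sum_t prb t * phib t = 0.
Proof.
rewrite sum_sign.
have [a0|a0] := eqVneq (prb sp1) 0; first by rewrite !phib_degenerate ?mulr0 ?addr0 //; left.
have [b0|b0] := eqVneq (prb sm1) 0; first by rewrite !phib_degenerate ?mulr0 ?addr0 //; right.
have [h1 h2 h3] := phib_regular a0 b0.
have s0 : phib sp1 != 0.
  by apply/eqP => s0; move: h3; rewrite s0 mul0r => /eqP; rewrite eq_sym oppr_eq0 oner_eq0.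
apply: (mulIf s0); rewrite mul0r.
transitivity (prb sp1 * phib sp1 ^+ 2 + prb sm1 * (phib sp1 * phib sm1)); first by ring.
by rewrite h1 h3 mulrN1 subrr.
Qed.

Lemma prb_phib2 : \sum_t prb t * phib t ^+ 2 <= 1.
Proof.
rewrite sum_sign.
have [a0|a0] := eqVneq (prb sp1) 0.
  by rewrite !phib_degenerate ?expr0n ?mulr0 ?addr0 //; left.
have [b0|b0] := eqVneq (prb sm1) 0.
  by rewrite !phib_degenerate ?expr0n ?mulr0 ?addr0 //; right.
by have [-> -> _] := phib_regular a0 b0; rewrite addrC prb_sum.
Qed.

Lemma phib_kernel (u t : sign) : 0 < prb u -> (u == t)%:R = prb t * (1 + phib u * phib t).
Proof.
have sgn (v : sign) : v = sp1 \/ v = sm1.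
  by have [|] := eqVneq v sm1; [right | rewrite -signE => /eqP; left].
have pm : (sp1 == sm1) = false by [].
have mp : (sm1 == sp1) = false by [].
have ab := prb_sum; move=> u0.
have [a0|a0] := eqVneq (prb sp1) 0.
  rewrite !phib_degenerate ?mulr0 ?addr0 ?mulr1; try by left.
  case: (sgn u) u0 => ->; rewrite ?a0 ?ltxx // => _.
  by case: (sgn t) => ->; rewrite ?a0 ?mp ?eqxx //; move: ab; rewrite a0 add0r.
have [b0|b0] := eqVneq (prb sm1) 0.
  rewrite !phib_degenerate ?mulr0 ?addr0 ?mulr1; try by right.
  case: (sgn u) u0 => ->; rewrite ?b0 ?ltxx // => _.
  by case: (sgn t) => ->; rewrite ?b0 ?pm ?eqxx //; move: ab; rewrite b0 addr0.
have [h1 h2 h3] := phib_regular a0 b0.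
have h3' : phib sm1 * phib sp1 = -1 by rewrite mulrC.
case: (sgn u) => ->; case: (sgn t) => ->; rewrite ?eqxx ?pm ?mp ?h3 ?h3' ?subrr ?mulr0 //.
  by rewrite mulrDr mulr1 (_ : phib sp1 * _ = phib sp1 ^+ 2) // h1.
by rewrite mulrDr mulr1 (_ : phib sm1 * _ = phib sm1 ^+ 2) // h2 addrC.
Qed.

Context (chi : nt_char R F).
Local Notation w := (fun a => normc (fourier chi (phib \o g) a)).

Lemma fourier_phib0 : w 0 = 0.
Proof.
rewrite /fourier /=; under eq_bigr do rewrite mul0r oppr0 chi0 mulr1.
rewrite -rmorph_sum -rmorphM /=; have := prb_avg phib; rewrite prb_phib1 => ->.
by rewrite -[LHS]/(normc (0%:C)%C) normc_real normr0.
Qed.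

Lemma fourier_phib2 : \sum_a w a ^+ 2 <= 1.
Proof. by rewrite parseval (prb_avg (fun t => phib t ^+ 2)) prb_phib2. Qed.

Lemma fourier_phib_le (a : F) : (forall k, (0 < k < 7)%N -> k%:R != 0 :> F) ->
  w a <= 2 / 3.
Proof.
move=> charF; have [->|a0] := eqVneq a 0; first by rewrite fourier_phib0; lra.
set N : R := #|F|%:R; have N0 : 0 < N by exact: card_gt0R.
pose A := [set x | g x == sp1]; pose z := \sum_(x in A) chi (- (a * x)).
pose d := phib sp1 - phib sm1.
have wE : fourier chi (phib \o g) a = (N^-1 * d)%:C%C * z.
  rewrite /fourier rmorphM -mulrA /=; congr (_ * _).
  have : \sum_x chi (- (a * x)) = 0.
    under eq_bigr => x _ do rewrite mulrC -mulrN.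
    by rewrite sum_chiM oppr_eq0 (negPf a0).
  rewrite (bigID (mem A)) /= -/z => /eqP; rewrite addr_eq0 => /eqP zE.
  rewrite (bigID (mem A)) /= rmorphB mulrBl {2}zE mulrN opprK /z !mulr_sumr.
  congr (_ + _); apply: eq_bigr => x; rewrite inE; first by move=> /eqP ->.
  by rewrite signE negbK => /eqP ->.
have d2 : d ^+ 2 * (prb sp1 * prb sm1) <= 1.
  rewrite /d; have [e0|e0] := eqVneq (prb sp1) 0; first by rewrite e0; lra.
  have [b0|b0] := eqVneq (prb sm1) 0; first by rewrite b0; lra.
  have [h1 h2 h3] := phib_regular e0 b0.
  have -> : (phib sp1 - phib sm1) ^+ 2 * (prb sp1 * prb sm1) =
    prb sm1 * (prb sp1 * phib sp1 ^+ 2) + prb sp1 * (prb sm1 * phib sm1 ^+ 2)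
    - 2 * (phib sp1 * phib sm1) * prb sp1 * prb sm1 by ring.
  rewrite h1 h2 h3 le_eqVlt; apply/orP; left; apply/eqP.
  transitivity ((prb sp1 + prb sm1) ^+ 2); first by ring.
  by rewrite prb_sum expr1n.
have z2 : normc z ^+ 2 <= 4 / 9 * N ^+ 2 * (prb sp1 * prb sm1).
  apply: le_trans (normc_subset chi charF A a0) _.
  have -> : prb sm1 = 1 - prb sp1 by rewrite -prb_sum addrC addKr.
  have -> : #|A|%:R = N * prb sp1 by rewrite /prb mulrC divfK // gt_eqF.
  by rewrite le_eqVlt; apply/orP; left; apply/eqP; ring.
rewrite -(@ler_pXn2r _ 2) ?nnegrE ?normc_ge0 ?divr_ge0 //.
rewrite wE normcM normc_real exprMn real_normK ?num_real // exprMn.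
apply: le_trans (ler_wpM2l _ z2) _; first by rewrite mulr_ge0 ?sqr_ge0.
have -> : N^-1 ^+ 2 * d ^+ 2 * (4 / 9 * N ^+ 2 * (prb sp1 * prb sm1)) =
  4 / 9 * (d ^+ 2 * (prb sp1 * prb sm1)) by field; rewrite gt_eqF.
by move: d2; set q := _ * (_ * _) => hq; clear - hq; lra.
Qed.

End OneBit.

(** * Leakage bias *)

Section LeakageBias.
Context (R : realType) (F : finFieldType) (m : nat) (C : {vspace 'rV[F]_m.+1}).
Context (h : 'I_m -> F -> sign).
Local Notation pr := (fun i => prb R (h i)).
Local Notation phi := (fun i => phib R (h i)).

Definition bias (s : F) (S : {set 'I_m}) : R :=
  (\sum_(c in sharings C s) \prod_(i in S) phi i (h i (c 0 (lift ord0 i))))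
    / #|sharings C s|%:R.

Lemma leakage_bias (s : F) (t : {ffun 'I_m -> sign}) :
  leakage R C h s t =
    (\prod_i pr i (t i)) * \sum_(S : {set 'I_m}) bias s S * \prod_(i in S) phi i (t i).
Proof.
have -> : leakage R C h s t =
    (\sum_(c in sharings C s) (transcript h c == t)%:R) / #|sharings C s|%:R.
  rewrite /leakage /uniform_pmf -sum1_card natr_sum big_mkcond /=.
  rewrite [in RHS]big_mkcond /=; congr (_ / _); apply: eq_bigr => c _.
  by rewrite inE; case: (c \in _) => //=; case: eqP.
have -> : \sum_(S : {set 'I_m}) bias s S * \prod_(i in S) phi i (t i) =
    (\sum_(c in sharings C s) \prod_i (1 + phi i (h i (c 0 (lift ord0 i))) * phi i (t i)))
      / #|sharings C s|%:R.
  rewrite mulr_suml; under [RHS]eq_bigr => c _.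
    under eq_bigr do rewrite addrC.
    rewrite bigA_distr mulr_suml.
    over.
  rewrite [RHS]exchange_big /=; apply: eq_bigr => S _.
  rewrite /bias mulrAC !mulr_suml; apply: eq_bigr => c _; congr (_ / _).
  by rewrite -big_split big_mkcond.
rewrite mulrA; congr (_ / _); rewrite mulr_sumr; apply: eq_bigr => c _.
rewrite -big_split /=.
have <- : \prod_i (h i (c 0 (lift ord0 i)) == t i)%:R = (transcript h c == t)%:R :> R.
  have [<-|ne] := eqVneq (transcript h c) t.
    by apply: big1 => i _; rewrite ffunE eqxx.
  have [i hi] : exists i, h i (c 0 (lift ord0 i)) != t i.
    apply/existsP; apply: contraT => /existsPn e; case/eqP: ne.
    by apply/ffunP => i; rewrite ffunE; apply/eqP/negPn/e.
  by rewrite (bigD1 i) //= (negPf hi) mul0r.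
by apply: eq_bigr => i _; apply: phib_kernel; exact: prb_gt0.
Qed.

Hypothesis (mC : MDS C).
Local Notation n := (\dim C).
Hypotheses (n1 : (1 < n)%N) (nm : (n <= m.+1)%N) (mn : (m + 2 <= 2 * n)%N).
Hypothesis charF : forall k, (0 < k < 7)%N -> k%:R != 0 :> F.
Context (chi : nt_char R F).

Lemma bias_set0 (s : F) : bias s finset.set0 = 1.
Proof.
rewrite /bias; under eq_bigr do rewrite big_set0.
rewrite sumr_const divff // pnatr_eq0 -lt0n; apply: sharings_neq0 => //.
by rewrite nm (ltnW n1).
Qed.

Lemma bias_le (s : F) (S : {set 'I_m}) : S != finset.set0 ->
  `|bias s S| <= (n <= #|S|)%:R * (2 / 3) ^+ (2 * n - 2 - #|S|).
Proof.
move=> S0; have Sgt0 : (0 < #|S|)%N by rewrite lt0n cards_eq0.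
have W0 : (0 < #|sharings C s|%:R :> R).
  by rewrite ltr0n; apply: sharings_neq0 => //; rewrite nm (ltnW n1).
have n0 : (0 < n <= m.+1)%N by rewrite nm (ltnW n1).
rewrite /bias normrM normfV (ger0_norm (ltW W0)) ler_pdivrMr // mulrC.
apply: le_trans (sharings_fourier chi _ _ _ (fun i => phib R (h i) \o h i)) _.
apply: ler_wpM2l; first exact: ltW.
pose w i a := normc (fourier chi (phib R (h i) \o h i) a).
have w0 i a : 0 <= w i a by exact: normc_ge0.
have wz i : w i 0 = 0 by exact: fourier_phib0.
have w2 i : \sum_a w i a ^+ 2 <= 1 by exact: fourier_phib2.
have wk i a : w i a <= 2 / 3 by exact: fourier_phib_le.
case: leqP => nS.
  rewrite mul1r; apply: (dual_sum_le mC n0 w0 w2 wk nS).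
  by apply: leq_trans mn; rewrite leq_add2r -[leqRHS]card_ord max_card.
by rewrite mul0r (dual_sum_eq0 mC n0 wz) // Sgt0.
Qed.

Lemma dTV_sqr_le (s s' : F) :
  dTV (leakage R C h s) (leakage R C h s') ^+ 2
    <= (4 / 9) ^+ (2 * n - 2) * (13 / 4) ^+ m.
Proof.
pose d S := bias s S - bias s' S.
have -> : dTV (leakage R C h s) (leakage R C h s') = 2^-1 *
    \sum_(t : {ffun 'I_m -> sign}) `|(\prod_i pr i (t i)) *
      \sum_(S : {set 'I_m}) d S * \prod_(i in S) phi i (t i)|.
  rewrite /dTV; congr (_ * _); apply: eq_bigr => t _.
  rewrite !leakage_bias -mulrBr -sumrB; congr `|_ * _|.
  by apply: eq_bigr => S _; rewrite mulrBl.
have l2 := @l1_sqr_le R 'I_m sign pr phi d (fun i t => prb_ge0 R (h i) t).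
rewrite exprMn; apply: le_trans (ler_wpM2l _ (l2 _ _ _)) _.
- by rewrite sqr_ge0.
- by move=> i; rewrite sum_sign prb_sum.
- by move=> i; exact: prb_phib1.
- by move=> i; exact: prb_phib2.
have -> : (4 / 9) ^+ (2 * n - 2) * (13 / 4) ^+ m =
    2^-1 ^+ 2 * \sum_(S : {set 'I_m}) 4 * ((4 / 9) ^+ (2 * n - 2) * (9 / 4) ^+ #|S|) :> R.
  rewrite -!mulr_sumr mulrA (_ : 2^-1 ^+ 2 * 4 = 1); last by field.
  rewrite mul1r; congr (_ * _).
  have -> : (13 / 4 : R) = 9 / 4 + 1 by field.
  rewrite -[m in LHS]card_ord -prodr_const bigA_distr /=.
  by apply: eq_bigr => S _; rewrite -big_mkcond prodr_const.
apply: ler_wpM2l; first exact: sqr_ge0.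
apply: ler_sum => S _.
have rhs0 : 0 <= 4 * ((4 / 9) ^+ (2 * n - 2) * (9 / 4) ^+ #|S|) :> R.
  by rewrite !mulr_ge0 ?exprn_ge0 ?divr_ge0.
have [->|S0] := eqVneq S finset.set0.
  by rewrite /d !bias_set0 subrr expr0n /= cards0 expr0 mulr1 mulr_ge0 ?exprn_ge0 ?divr_ge0.
have B := bias_le s S0; have B' := bias_le s' S0.
have [nS|nS] := leqP n #|S|; last first.
  move: B B'; rewrite leqNgt nS mul0r !normr_le0 => /eqP B /eqP B'.
  by rewrite /d B B' subrr expr0n.
have cS : (#|S| <= 2 * n - 2)%N.
  apply: leq_trans (max_card _) _; rewrite card_ord; move: mn; clear; lia.
move: B B'; rewrite nS !mul1r; set k := (_ ^+ _) => B B'.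
have k0 : 0 <= k by apply: le_trans B.
have dk : `|d S| <= 2 * k.
  by rewrite mulr_natl mulr2n; apply: le_trans (ler_normB _ _) (lerD B B').
rewrite -real_normK ?num_real //; apply: (@le_trans _ _ ((2 * k) ^+ 2)).
  by rewrite ler_pXn2r ?nnegrE ?mulr_ge0.
rewrite exprMn (_ : (2 : R) ^+ 2 = 4); last by rewrite expr2; ring.
rewrite ler_pM2l ?ltr0n // le_eqVlt; apply/orP; left; apply/eqP.
rewrite /k exprAC (_ : (2 / 3 : R) ^+ 2 = 4 / 9); last by field.
rewrite -[in RHS](subnK cS) exprD -mulrA -exprMn (_ : 4 / 9 * (9 / 4) = 1 :> R); last by field.
by rewrite expr1n mulr1.
Qed.

End LeakageBias.

Lemma rate_numeric (R : realFieldType) :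
  (13 / 4) ^+ 16 * (2 / 3) ^+ 47 <= (10 / 11) ^+ 2 :> R.
Proof.
have -> : (13 / 4) ^+ 16 * (2 / 3) ^+ 47 = (26 / 27) ^+ 16 * (3 / 2) :> R.
  have -> : (26 / 27 : R) = 13 / 4 * (2 / 3) ^+ 3 by field.
  rewrite [in RHS]exprMn -exprM -[RHS]mulrA; congr (_ * _).
  by rewrite (_ : (3 * 16 = 47 + 1)%N) // exprD expr1 -mulrA
     (_ : 2 / 3 * (3 / 2) = 1 :> R) ?mulr1 //; field.
have a1 : (26 / 27 : R) ^+ 2 <= 64 / 69 by rewrite expr2; lra.
have sq n (x y : R) : 0 <= x ^+ n -> x ^+ n <= y -> x ^+ (n * 2) <= y ^+ 2.
  by move=> x0 xy; rewrite exprM ler_pXn2r // nnegrE (le_trans x0).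
have x0 n : 0 <= (26 / 27 : R) ^+ n by rewrite exprn_ge0 // divr_ge0.
have a2 : (26 / 27 : R) ^+ 4 <= 37 / 43.
  by apply: le_trans (sq 2%N _ _ (x0 _) a1) _; rewrite expr2; lra.
have a3 : (26 / 27 : R) ^+ 8 <= 20 / 27.
  by apply: le_trans (sq 4%N _ _ (x0 _) a2) _; rewrite expr2; lra.
have a4 : (26 / 27 : R) ^+ 16 <= 11 / 20.
  by apply: le_trans (sq 8%N _ _ (x0 _) a3) _; rewrite expr2; lra.
by rewrite [leRHS]expr2; move: a4; set q := _ ^+ _; clear; lra.
Qed.

Lemma dTV_exp_bound (R : realFieldType) (m n : nat) (x : R) :
  0 <= x -> (336 <= m)%N -> (0 < n)%N -> (47 * m <= 64 * n)%N ->
  x ^+ 2 <= (4 / 9) ^+ (2 * n - 2) * (13 / 4) ^+ m -> x ^+ 256 <= 2^-1 ^+ m.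
Proof.
move=> x0 m336 n0 mn hx.
have y0 : 0 <= 10 / 11 :> R by lra.
have m0 : (0 < m)%N by apply: leq_trans m336.
have h1 : x ^+ 32 <= (9 / 4) ^+ 32 * ((10 / 11) ^+ 2) ^+ m.
  rewrite (exprM x 2 16).
  apply: (@le_trans _ _ (((4 / 9) ^+ (2 * n - 2) * (13 / 4) ^+ m) ^+ 16)).
    by rewrite ler_pXn2r ?nnegrE ?sqr_ge0 // mulr_ge0 ?exprn_ge0 ?divr_ge0.
  have -> : (4 / 9) ^+ (2 * n - 2) = (9 / 4) ^+ 2 * (4 / 9) ^+ (2 * n) :> R.
    rewrite -[in RHS](@subnK 2 (2 * n)) ?exprD; last by move: n0; clear; lia.
    rewrite mulrCA -exprMn (_ : 9 / 4 * (4 / 9) = 1 :> R) ?expr1n ?mulr1 //.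
    by field.
  rewrite -mulrA exprMn (_ : ((9 / 4) ^+ 2) ^+ 16 = (9 / 4) ^+ 32); last by rewrite -exprM.
  apply: ler_wpM2l; first by rewrite exprn_ge0 // divr_ge0.
  have -> : (4 / 9 : R) = (2 / 3) ^+ 2 by field.
  rewrite exprMn -!exprM.
  apply: (@le_trans _ _ ((2 / 3) ^+ (47 * m) * (13 / 4) ^+ (m * 16))).
    apply: ler_wpM2r; first by rewrite exprn_ge0 // divr_ge0.
    apply: ler_wiXn2l; [by lra | by lra | by move: mn; clear; lia].
  rewrite [(m * 16)%N]mulnC !exprM -exprMn mulrC.
  rewrite ler_pXn2r ?nnegrE ?mulr_ge0 ?exprn_ge0 ?divr_ge0 //; exact: rate_numeric.
have h2 : (9 / 4) ^+ 32 * (10 / 11) ^+ m <= 1 :> R.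
  apply: (@le_trans _ _ (2 ^+ 42 * (10 / 11) ^+ 336)).
    apply: ler_pM; rewrite ?exprn_ge0 ?divr_ge0 //.
      apply: (@le_trans _ _ ((9 / 4) ^+ (5 * 7))); first by apply: ler_weXn2l => //; lra.
      rewrite exprM (_ : 42%N = (6 * 7)%N) // exprM ler_pXn2r ?nnegrE ?exprn_ge0 ?divr_ge0 //.
      by rewrite !exprS expr0; lra.
    by apply: ler_wiXn2l => //; lra.
  rewrite (_ : 336%N = (8 * 42)%N) // exprM -exprMn exprn_ile1 ?mulr_ge0 ?exprn_ge0 //.
  by rewrite !exprS expr0; lra.
have h3 : x ^+ 32 <= (10 / 11) ^+ m.
  apply: le_trans h1 _; rewrite exprAC expr2 mulrA -[leRHS]mul1r.
  by apply: ler_wpM2r => //; rewrite exprn_ge0.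
rewrite (exprM x 32 8); apply: (@le_trans _ _ (((10 / 11) ^+ m) ^+ 8)).
  by rewrite ler_pXn2r ?nnegrE ?exprn_ge0.
rewrite exprAC ler_pXn2r ?nnegrE ?exprn_ge0 ?invr_ge0 //; last first.
by rewrite !exprS expr0; lra.
Qed.

Theorem proposition1p13 (R : realType) (mu : R)
    (hmu : 7496%:R / 10000%:R <= 2 * mu) (hmu1 : 2 * mu < 1) :
  exists (c : R) (M : nat), 0 < c /\
    forall (m n : nat), (M <= m)%N -> n%:R = 2 * mu * m%:R ->
    forall p : nat, prime p ->
    forall C : {vspace 'rV['F_p]_m.+1}, \dim C = n -> MDS C ->
    forall (h : 'I_m -> 'F_p -> sign) (s s' : 'F_p),
      dTV (leakage R C h s) (leakage R C h s') <= 2 `^ (- (c * m%:R)).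
Proof.
have e0 : 0 < 1 - 2 * mu by rewrite subr_gt0.
exists (1 / 256), (maxn 336 (Num.bound (5 / (1 - 2 * mu)))); split; first by lra.
move=> m n; rewrite geq_max => /andP[m336 mM] nE p pp C dimC mC h s s'.
have hm : 5 + n%:R < m%:R + 1 :> R.
  have : 5 / (1 - 2 * mu) < m%:R.
    apply: lt_le_trans (archi_boundP _) _; first by rewrite divr_ge0 // ltW.
    by rewrite ler_nat.
  by rewrite ltr_pdivrMr // => h5; move: nE h5; clear; set x := _%:R => -> h5; nra.
have n5 : (5 + n <= m)%N by rewrite -ltnS -(ltr_nat R) natrD -[m.+1%:R]natr1.
have mn : (47 * m <= 64 * n)%N.
  rewrite -(ler_nat R) !natrM nE; have m0 : 0 <= m%:R :> R by exact: ler0n.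
  by nra.
have n1 : (1 < n)%N by move: m336 mn; clear; lia.
have p7 : (7 <= p)%N.
  have : (m.+1 - n < #|'F_p|)%N.
    have := @MDS_field_size _ _ C mC; rewrite dimC; apply.
    by rewrite n1 /=; move: n5; clear; lia.
  by rewrite card_Fp //; move: n5; clear; lia.
have charF k : (0 < k < 7)%N -> k%:R != 0 :> 'F_p.
  move=> /andP[k0 k7]; rewrite -(dvdn_pcharf (pchar_Fp pp)).
  by apply/negP => /dvdn_leq -/(_ k0); move: k7 p7; clear; lia.
have dtv0 : 0 <= dTV (leakage R C h s) (leakage R C h s').
  by rewrite mulr_ge0 ?invr_ge0 // sumr_ge0.
have := @dTV_sqr_le R _ m C h mC; rewrite dimC.
move=> /(_ n1 _ _ charF (Fp_nt_char R pp) s s') hd.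
have {hd} := dTV_exp_bound dtv0 m336 (ltnW n1) mn (hd _ _) => hd.
rewrite -(@ler_pXn2r _ 256) ?nnegrE ?powR_ge0 //.
apply: le_trans (hd _ _) _; rewrite ?(leq_trans _ n5) //.
- by move: n5; clear; lia.
- by move: m336 mn; clear; lia.
rewrite -[leRHS]powR_mulrn ?powR_ge0 // -powRrM -[leLHS]powR_mulrn ?invr_ge0 //.
rewrite -[2^-1]powR_inv1 // -powRrM le_eqVlt; apply/orP; left; apply/eqP; congr (_ `^ _).
by field.
Qed.
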